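(* Any $n$-vertex graph admits a voxel representation of size $O(n^2)$. That is, there is an absolute constant $C>0$ such that for every integer $n\ge 1$, every graph with $n$ vertices has a voxel representation of size at most $C\,n^2$.
   Context: All graphs are finite and simple. A voxel is a cell of the unit cube grid in 3-dimensional space; two distinct voxels are adjacent if they share a face. A blob is a nonempty finite set of voxels that is connected with respect to this adjacency. A voxel representation of a graph $G=(V,E)$ assigns to each vertex $v\in V$ a blob $B_v$ such that the blobs of distinct vertices are disjoint and, for all distinct $u,v\in V$, some voxel of $B_u$ is adjacent to some voxel of $B_v$ if and only if $uv\in E$. Its size is $\sum_{v\in V}|B_v|$. *)

(* Defs.v *)
From mathcomp Require Import all_boot all_order all_algebra.
From mathcomp Require Import finmap.
From mathcomp Require Import zify.

Set Implicit Arguments.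
Unset Strict Implicit.
Unset Printing Implicit Defensive.

Import GRing.Theory Num.Theory.

Local Open Scope ring_scope.

(* (x, y, z) stands for the cell [x, x+1] * [y, y+1] * [z, z+1]. *)
Definition voxel : Type := (int * int * int)%type.

(* (a, p) is the unit square orthogonal to axis a with least corner p. *)
Definition face : Type := ('I_3 * (int * int * int))%type.

Definition voxel_faces (v : voxel) : seq face :=
  let: (x, y, z) := v in
  [:: (inord 0, (x, y, z)); (inord 0, (x + 1, y, z));
      (inord 1, (x, y, z)); (inord 1, (x, y + 1, z));
      (inord 2, (x, y, z)); (inord 2, (x, y, z + 1))].

Definition voxel_adj : rel voxel := fun u v =>
  (u != v) && has (mem (voxel_faces v)) (voxel_faces u).

Lemma voxel_adjE (x y z x' y' z' : int) :
  voxel_adj (x, y, z) (x', y', z') =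
    [|| (`|x - x'| == 1) && (y == y') && (z == z'),
        (x == x') && (`|y - y'| == 1) && (z == z') |
        (x == x') && (y == y') && (`|z - z'| == 1)].
Proof.
have E (i j : nat) : (i < 3)%N -> (j < 3)%N ->
    ((inord i : 'I_3) == inord j) = (i == j).
  by move=> ? ?; rewrite -val_eqE /= !inordK.
have D (a b : int) : (`|a - b| == 1) = (a == b + 1) || (a + 1 == b) by lia.
have L (a b : int) : a == b -> (a == b + 1 = false) * (a + 1 == b = false).
  by move=> ?; split; lia.
have S (a b : int) : (a + 1 == b + 1) = (a == b) by lia.
rewrite /voxel_adj /voxel_faces /= !inE !xpair_eqE !E //= !D !S.
case: (boolP (x == x')) (L x x') => [_ /(_ isT) Hx|_ _];
  case: (boolP (y == y')) (L y y') => [_ /(_ isT) Hy|_ _];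
  case: (boolP (z == z')) (L z z') => [_ /(_ isT) Hz|_ _];
  by rewrite ?Hx ?Hy ?Hz /= ?andbT ?andbF ?orbF.
Qed.

Definition is_blob (B : {fset voxel}) : Prop :=
  B != fset0 /\
  (forall u v : voxel, u \in B -> v \in B ->
     exists p : seq voxel,
       [/\ path voxel_adj u p, all (fun w => w \in B) p & last u p = v]).

Definition blobs_touch (A B : {fset voxel}) : Prop :=
  exists a b : voxel, [/\ a \in A, b \in B & voxel_adj a b].

Definition voxel_representation (V : finType) (E : rel V)
    (B : V -> {fset voxel}) : Prop :=
  [/\ forall v : V, is_blob (B v),
      forall u v : V, u != v -> fdisjoint (B u) (B v) &
      forall u v : V, u != v -> (blobs_touch (B u) (B v) <-> E u v)].

Definition representation_size (V : finType) (B : V -> {fset voxel}) : nat :=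
  (\sum_(v : V) #|` B v|)%N.

(* Main.v *)
(** Give the i-th vertex a horizontal bar along the x-axis at y = 2i, z = 0, a
    bar along the y-axis at x = 2i, z = 2, and, in the layer z = 1, the voxel
    (2i, 2i) joining its two bars. The x-bar of i lies below the y-bar of j at
    the crossing (2j, 2i), so for an edge ij the voxel (2j, 2i, 1), given to i,
    creates the required contact. The coordinates 2i keep everything else
    apart. Each vertex uses at most 2n + 2n + n voxels. *)

Require Import Defs.
From mathcomp Require Import all_boot all_order all_algebra.
From mathcomp Require Import finmap.
From mathcomp Require Import zify.

(** The path clause of [is_blob], named so that paths can be concatenated. *)
Definition connected_in (B : {fset voxel}) (u v : voxel) : Prop :=
  exists p : seq voxel,
    [/\ path voxel_adj u p, all (fun w => w \in B) p & last u p = v].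

Lemma voxel_adj_sym : symmetric voxel_adj.
Proof.
move=> [[x y] z] [[x' y'] z']; rewrite !voxel_adjE.
by rewrite ![(`|x' - x|)%R]Num.Theory.distrC ![(`|y' - y|)%R]Num.Theory.distrC
  ![(`|z' - z|)%R]Num.Theory.distrC (eq_sym x') (eq_sym y') (eq_sym z').
Qed.

Lemma connected_in_refl B u : connected_in B u u.
Proof. by exists [::]. Qed.

Lemma connected_in_trans B v u w :
  connected_in B u v -> connected_in B v w -> connected_in B u w.
Proof.
move=> [p [up pB pv]] [q [vq qB qw]]; exists (p ++ q).
by rewrite cat_path all_cat last_cat pv up vq pB qB.
Qed.

Lemma connected_in_adj (B : {fset voxel}) u v :
  v \in B -> voxel_adj u v -> connected_in B u v.
Proof. by move=> vB uv; exists [:: v]; rewrite /= vB uv. Qed.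

(** Induction along the segment links each [f k] with [f 0] in both directions, so [f 0] is a
    waypoint from [f a] to [f b]. Used with [f] a bar. *)
Lemma connected_in_segment (B : {fset voxel}) (f : nat -> voxel) (m a b : nat) :
  (forall k, voxel_adj (f k) (f k.+1)) -> (forall k, k < m -> f k \in B) ->
  a < m -> b < m -> connected_in B (f a) (f b).
Proof.
move=> fadj fB am bm.
suff to0 k : k < m -> connected_in B (f k) (f 0) /\ connected_in B (f 0) (f k).
  by apply: (@connected_in_trans _ (f 0)); [case: (to0 a am) | case: (to0 b bm)].
elim: k => [|k IHk] km; first by split; apply: connected_in_refl.
have [k0 k1] := IHk (ltnW km).
split.
  apply: connected_in_trans k0.
  by apply: connected_in_adj; [apply/fB/ltnW | rewrite voxel_adj_sym].
by apply: (connected_in_trans _ _ _ _ k1); apply: connected_in_adj => //; apply: fB.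
Qed.

Lemma is_blob_hub (B : {fset voxel}) (h : voxel) :
  h \in B ->
  (forall u, u \in B -> connected_in B u h /\ connected_in B h u) ->
  is_blob B.
Proof.
move=> hB hub; split; first by apply/fset0Pn; exists h.
move=> u v uB vB; have [uh _] := hub _ uB; have [_ hv] := hub _ vB.
exact: connected_in_trans uh hv.
Qed.

Section CrossingBars.

Variables (V : finType) (E : rel V).
Hypothesis symE : symmetric E.

Let n := #|V|.
Let r (v : V) : nat := enum_rank v.

Let r_lt v : r v < n. Proof. exact: ltn_ord. Qed.

Let r_inj u v : r u = r v -> u = v.
Proof. by move=> /val_inj /enum_rank_inj. Qed.

Definition xbar (v : V) (k : nat) : voxel := (Posz k, Posz (2 * r v), Posz 0).
Definition ybar (v : V) (k : nat) : voxel := (Posz (2 * r v), Posz k, Posz 2).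
(** Lies between [xbar v (2 * r w)] below and [ybar w (2 * r v)] above; for [w = v] it joins the two
    bars of [v]. *)
Definition connector (v w : V) : voxel :=
  (Posz (2 * r w), Posz (2 * r v), Posz 1).

Definition bars_seq (v : V) : seq voxel :=
  [seq xbar v k | k <- iota 0 (2 * n)] ++ [seq ybar v k | k <- iota 0 (2 * n)]
  ++ [seq connector v w | w <- enum V & (w == v) || E v w].

Definition bars (v : V) : {fset voxel} := [fset p in bars_seq v]%fset.

Variant bars_spec (v : V) : voxel -> Prop :=
  | BarsX k of k < 2 * n : bars_spec v (xbar v k)
  | BarsY k of k < 2 * n : bars_spec v (ybar v k)
  | BarsC w of (w == v) || E v w : bars_spec v (connector v w).

Lemma barsP v p : reflect (bars_spec v p) (p \in bars v).
Proof.
rewrite in_fset /= /bars_seq !mem_cat; apply: (iffP or3P).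
  case=> /mapP[k + ->].
  - by rewrite mem_iota => kn; constructor.
  - by rewrite mem_iota => kn; constructor.
  - by rewrite mem_filter => /andP[kv _]; constructor.
case=> [k kn|k kn|w vw].
- by constructor 1; apply: map_f; rewrite mem_iota.
- by constructor 2; apply: map_f; rewrite mem_iota.
- by constructor 3; apply: map_f; rewrite mem_filter vw mem_enum.
Qed.

Lemma card_bars v : #|` bars v| <= 5 * n.
Proof.
apply: (@leq_trans (size (bars_seq v))).
  by rewrite card_fseq size_undup.
rewrite !size_cat !size_map !size_iota size_filter.
apply: (@leq_trans (2 * n + (2 * n + n))); last by lia.
by rewrite !leq_add2l /n cardE count_size.
Qed.

(** The hub is [connector v v]: each bar is followed to its voxel at position [2 * r v], next to the
    hub, and any other connector first drops to the x-bar. *)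
Lemma bars_is_blob v : is_blob (bars v).
Proof.
have rv := r_lt v.
have hB : connector v v \in bars v by apply/barsP; constructor; rewrite eqxx.
have xB k : k < 2 * n -> xbar v k \in bars v by move=> ?; apply/barsP; constructor.
have yB k : k < 2 * n -> ybar v k \in bars v by move=> ?; apply/barsP; constructor.
have xx a b : a < 2 * n -> b < 2 * n -> connected_in (bars v) (xbar v a) (xbar v b).
  by apply: connected_in_segment => // k; rewrite voxel_adjE; lia.
have yy a b : a < 2 * n -> b < 2 * n -> connected_in (bars v) (ybar v a) (ybar v b).
  by apply: connected_in_segment => // k; rewrite voxel_adjE; lia.
have xc w : voxel_adj (xbar v (2 * r w)) (connector v w).
  by rewrite voxel_adjE; lia.
have yc : voxel_adj (ybar v (2 * r v)) (connector v v).
  by rewrite voxel_adjE; lia.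
have r2 w : 2 * r w < 2 * n by have := r_lt w; lia.
have xh k : k < 2 * n -> connected_in (bars v) (xbar v k) (connector v v)
                      /\ connected_in (bars v) (connector v v) (xbar v k).
  move=> kn; split.
    apply: connected_in_trans (xx _ _ kn (r2 v)) _.
    exact: connected_in_adj.
  apply: connected_in_trans (xx _ _ (r2 v) kn).
  by apply: connected_in_adj; rewrite ?xB // voxel_adj_sym.
apply: (is_blob_hub _ _ hB) => u /barsP[k kn|k kn|w vw].
- exact: xh.
- split.
    apply: connected_in_trans (yy _ _ kn (r2 v)) _.
    exact: connected_in_adj.
  apply: connected_in_trans (yy _ _ (r2 v) kn).
  by apply: connected_in_adj; rewrite ?yB // voxel_adj_sym.
- have [wh hw] := xh _ (r2 w); split.
    apply: connected_in_trans wh.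
    by apply: connected_in_adj; rewrite ?xB // voxel_adj_sym.
  apply: (connected_in_trans _ _ _ _ hw).
  by apply: connected_in_adj => //; apply/barsP; constructor.
Qed.

Lemma bars_disjoint u v : u != v -> fdisjoint (bars u) (bars v).
Proof.
move=> uv; have ruv : r u <> r v by move=> /r_inj; apply/eqP.
apply/fdisjointP => p /barsP pu; apply/negP => /barsP pv.
(* The height z tells the three kinds apart. Within one kind, the owner's rank is read off the
   y-coordinate (x-bars, connectors) or the x-coordinate (y-bars). *)
by case: pu pv => [k _|k _|w _] pv; inversion pv; lia.
Qed.

Lemma bars_touch u v : u != v -> blobs_touch (bars u) (bars v) <-> E u v.
Proof.
move=> uv; have ruv : r u <> r v by move=> /r_inj; apply/eqP.
split; last first.
  (* The contact is at the crossing of the x-bar of [u] with the y-bar of [v]. *)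
  move=> Euv; exists (connector u v), (ybar v (2 * r u)); split.
  - by apply/barsP; constructor; rewrite Euv orbT.
  - by apply/barsP; constructor; have := r_lt u; lia.
  - by rewrite voxel_adjE; lia.
case=> a [b [/barsP au /barsP bv]].
(* Except for a y-bar against a connector, some coordinate differs by at least 2: z for an x-bar
   against a y-bar, otherwise the doubled rank of the owners. In the two remaining cases the
   connector lies right below the y-bar, so its second index is the owner of that bar. *)
case: au => [k _|k _|w uw]; case: bv => [l _|l _|w' vw'];
  rewrite voxel_adjE => ab; try by exfalso; lia.
- have /r_inj uw' : r u = r w' by lia.
  by move: vw'; rewrite -uw' (negPf uv) symE.
- have /r_inj wv : r w = r v by lia.
  by move: uw; rewrite wv eq_sym (negPf uv).
Qed.

End CrossingBars.

Theorem theorem9 :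
  exists C : nat, 0 < C /\
    forall (n : nat), 1 <= n ->
    forall (V : finType) (E : rel V),
      symmetric E -> irreflexive E -> #|V| = n ->
      exists B : V -> {fset voxel},
        voxel_representation E B /\ representation_size B <= C * n ^ 2.
Proof.
exists 5; split=> // n _ V E symE _ cardV; exists (bars V E); split.
  split; [exact: bars_is_blob | exact: bars_disjoint | exact: bars_touch].
(* Summing the bound [5 * n] over the [n] vertices gives the constant 5. *)
apply: (@leq_trans (\sum_(v : V) 5 * n)).
  by apply: leq_sum => v _; rewrite -cardV card_bars.
by rewrite sum_nat_const cardV; lia.
Qed.
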